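(* Let $W$ be a model of $\mathrm{ZFC}^-$. If the $\mathrm{DC}_\delta$-scheme holds in $W$ for a cardinal $\delta$ of $W$, then every proper class of $W$ is $\delta$-big in $W$. It follows that over $\mathrm{ZFC}^-$, the $\mathrm{DC}_{<\mathrm{Ord}}$-scheme implies that every proper class is big.
   Context: $\mathrm{ZFC}^-$ is the theory consisting of extensionality, empty set, pairing, unions, infinity, the foundation scheme, the separation scheme, the replacement scheme, the collection scheme, and the well-ordering principle (every set can be well-ordered); there is no power set axiom. Classes of a model of $\mathrm{ZFC}^-$ are the collections definable over it by a formula with set parameters; a proper class is a class that is not a set. For an infinite cardinal $\delta$, the $\mathrm{DC}_\delta$-scheme asserts for every formula $\varphi(x,y,a)$ that if for every set $x$ there is a set $y$ such that $\varphi(x,y,a)$ holds, then there is a function $f$ on $\delta$ such that for every $\xi<\delta$, $\varphi(f\restriction\xi,f(\xi),a)$ holds. The $\mathrm{DC}_{<\mathrm{Ord}}$-scheme asserts that the $\mathrm{DC}_\delta$-scheme holds for every cardinal $\delta$. A class is $\delta$-big if it surjects onto $\delta$ (via a class function). A class is big if it surjects onto every (non-zero) cardinal. *)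

(* Defs.v *)
(** A structure in the language of set theory; [mem] is not assumed to be
    well-founded. *)
Record structure := Structure {
  carrier :> Type;
  mem : carrier -> carrier -> Prop
}.

Arguments mem {_} _ _.

Declare Scope set_theory_scope.
Delimit Scope set_theory_scope with set_theory.
Notation "x ∈ y" := (mem x y) (at level 70, no associativity)
  : set_theory_scope.
Notation "x ∉ y" := (~ mem x y) (at level 70, no associativity)
  : set_theory_scope.
Open Scope set_theory_scope.

(** First-order formulas with de Bruijn indices: [fAll] and [fEx] bind index 0
    and shift the others by one. *)
Inductive formula : Type :=
| fMem : nat -> nat -> formula
| fEq  : nat -> nat -> formula
| fNot : formula -> formula
| fAnd : formula -> formula -> formula
| fOr  : formula -> formula -> formula
| fImp : formula -> formula -> formula
| fAll : formula -> formula
| fEx  : formula -> formula.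

Definition scons {T : Type} (x : T) (s : nat -> T) : nat -> T :=
  fun n => match n with O => x | S m => s m end.

Notation "x .: s" := (scons x s) (at level 55, right associativity)
  : set_theory_scope.

(** A formula mentions only finitely many indices, so the tail of an
    assignment plays the role of a finite tuple of set parameters. *)
Fixpoint sat {W : structure} (s : nat -> W) (phi : formula) : Prop :=
  match phi with
  | fMem i j => s i ∈ s j
  | fEq i j => s i = s j
  | fNot p => ~ sat s p
  | fAnd p q => sat s p /\ sat s q
  | fOr p q => sat s p \/ sat s q
  | fImp p q => sat s p -> sat s q
  | fAll p => forall x : W, sat (x .: s) p
  | fEx p => exists x : W, sat (x .: s) p
  end.

Section SetTheory.

Variable W : structure.
Implicit Types (x y z a b f g k m n r : W) (A B F : W -> Prop).

Definition is_empty x : Prop := forall y, y ∉ x.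

Definition is_subset x y : Prop := forall z, z ∈ x -> z ∈ y.

Definition is_upair z x y : Prop := forall a, a ∈ z <-> a = x \/ a = y.

(** Kuratowski pair: [z = {{x}, {x, y}}]. *)
Definition is_opair z x y : Prop :=
  exists a b, is_upair a x x /\ is_upair b x y /\ is_upair z a b.

Definition is_succ y x : Prop := forall z, z ∈ y <-> z ∈ x \/ z = x.

(** Relations and functions are collections [F : W -> Prop] of pairs, so that
    the notions below apply both to sets, through [elts], and to classes. *)

Definition elts a : W -> Prop := fun x => x ∈ a.

Definition related F x y : Prop := exists z, is_opair z x y /\ F z.

Definition function_on F A : Prop :=
  (forall z, F z -> exists x y, is_opair z x y /\ A x) /\
  (forall x, A x -> exists! y, related F x y).

Definition injective_rel F : Prop :=
  forall x x' y, related F x y -> related F x' y -> x = x'.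

Definition surjection F A B : Prop :=
  function_on F A /\ (forall y, B y <-> exists x, related F x y).

Definition bijection F A B : Prop := surjection F A B /\ injective_rel F.

Definition is_restriction g f a : Prop :=
  forall z, z ∈ g <-> z ∈ f /\ exists x y, is_opair z x y /\ x ∈ a.

Definition well_orders (R : W -> W -> Prop) x : Prop :=
  (forall a, a ∈ x -> ~ R a a) /\
  (forall a b c, a ∈ x -> b ∈ x -> c ∈ x -> R a b -> R b c -> R a c) /\
  (forall a b, a ∈ x -> b ∈ x -> R a b \/ a = b \/ R b a) /\
  (forall y, is_subset y x -> ~ is_empty y ->
     exists m, m ∈ y /\ forall a, a ∈ y -> a = m \/ R m a).

Definition is_ordinal x : Prop :=
  (forall y, y ∈ x -> is_subset y x) /\ well_orders mem x.

Definition is_cardinal k : Prop :=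
  is_ordinal k /\
  ~ exists a f, a ∈ k /\ bijection (elts f) (elts a) (elts k).

(** An ordinal such that it and all its elements are empty or successors. *)
Definition is_natural n : Prop :=
  is_ordinal n /\
  forall m, m ∈ n \/ m = n -> is_empty m \/ exists x, is_succ m x.

Definition is_infinite_cardinal k : Prop :=
  is_cardinal k /\ forall n, is_natural n -> n ∈ k.

Record ZFCminus : Prop := {
  extensionality :
    forall x y, (forall z, z ∈ x <-> z ∈ y) -> x = y;
  empty_set :
    exists x, is_empty x;
  pairing :
    forall x y, exists z, is_upair z x y;
  unions :
    forall x, exists y, forall z, z ∈ y <-> exists a, a ∈ x /\ z ∈ a;
  infinity :
    exists x, (exists y, is_empty y /\ y ∈ x) /\
      forall y, y ∈ x -> exists z, is_succ z y /\ z ∈ x;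
  foundation_scheme :
    forall (phi : formula) (s : nat -> W),
      (exists x, sat (x .: s) phi) ->
      exists x, sat (x .: s) phi /\ forall y, y ∈ x -> ~ sat (y .: s) phi;
  separation_scheme :
    forall (phi : formula) (s : nat -> W) a,
      exists b, forall x, x ∈ b <-> x ∈ a /\ sat (x .: s) phi;
  replacement_scheme :
    forall (phi : formula) (s : nat -> W) a,
      (forall x, x ∈ a -> exists! y, sat (x .: y .: s) phi) ->
      exists b, forall y, y ∈ b <-> exists x, x ∈ a /\ sat (x .: y .: s) phi;
  collection_scheme :
    forall (phi : formula) (s : nat -> W) a,
      (forall x, x ∈ a -> exists y, sat (x .: y .: s) phi) ->
      exists b, forall x, x ∈ a -> exists y, y ∈ b /\ sat (x .: y .: s) phi;
  well_ordering_principle :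
    forall x, exists r, well_orders (related (elts r)) x
}.

Definition is_class A : Prop :=
  exists (phi : formula) (s : nat -> W), forall x, A x <-> sat (x .: s) phi.

Definition is_proper_class A : Prop :=
  is_class A /\ ~ exists a, forall x, A x <-> x ∈ a.

Definition is_delta_big (delta : W) A : Prop :=
  exists F, is_class F /\ surjection F A (elts delta).

Definition is_big A : Prop :=
  forall k, is_cardinal k -> ~ is_empty k -> is_delta_big k A.

Definition DC_scheme (delta : W) : Prop :=
  forall (phi : formula) (s : nat -> W),
    (forall x, exists y, sat (x .: y .: s) phi) ->
    exists f, function_on (elts f) (elts delta) /\
      forall xi, xi ∈ delta ->
        exists g y, is_restriction g f xi /\ related (elts f) xi y /\
                    sat (g .: y .: s) phi.

Definition DC_lt_Ord_scheme : Prop :=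
  forall delta, is_infinite_cardinal delta -> DC_scheme delta.

End SetTheory.

Arguments is_infinite_cardinal {W} _.
Arguments is_proper_class {W} _.
Arguments is_delta_big {W} _ _.
Arguments is_big {W} _.
Arguments DC_scheme {W} _.

(* Main.v *)
From Stdlib Require Import Classical Arith.
Require Import Defs.

(** Let [A] be a proper class and let [delta] satisfy the dependent choice
    scheme.  No set covers [A]: otherwise separation would turn [A] into a set.
    In particular every set [x] leaves some [y] of [A] outside the set [⋃⋃x],
    which contains all values of [x] when [x] is a function.  Dependent choice
    along the relation [y ∈ A ∧ y ∉ ⋃⋃x] gives a function [f] on [delta] with
    values in [A] whose value at each stage differs from all earlier ones
    ([injection_of_DC]).  So [f] is injective; inverting it on its range, and
    sending the rest of [A] to a fixed element of [delta], maps [A] onto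
    [delta] ([delta_big_of_injection]).

    For bigness, an infinite cardinal is covered by the above.  A cardinal that
    omits some natural number is itself a natural number, since ordinals are
    comparable ([natural_of_not_mem]).  Dependent choice says nothing about
    those, but a set injection of a natural number into [A] is built by internal
    induction ([injection_of_natural]), each step adding a point of [A] outside
    the double union of the injection obtained so far.

    Both the dependent choice scheme and the induction need formulas.  They are
    obtained from closure properties of definable relations with parameters
    instead of being written out. *)

Arguments is_empty {W} _.
Arguments is_subset {W} _ _.
Arguments is_upair {W} _ _ _.
Arguments is_opair {W} _ _ _.
Arguments is_succ {W} _ _.
Arguments elts {W} _ _.
Arguments related {W} _ _ _.
Arguments function_on {W} _ _.
Arguments injective_rel {W} _.
Arguments surjection {W} _ _ _.
Arguments is_restriction {W} _ _ _.
Arguments is_ordinal {W} _.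
Arguments is_cardinal {W} _.
Arguments is_natural {W} _.
Arguments is_class {W} _.

(** * Definable relations with parameters *)

(** Renaming of variables under a binder. *)
Definition up (r : nat -> nat) : nat -> nat :=
  0 .: (fun n => S (r n)).

Fixpoint rename (r : nat -> nat) (phi : formula) : formula :=
  match phi with
  | fMem i j => fMem (r i) (r j)
  | fEq i j => fEq (r i) (r j)
  | fNot p => fNot (rename r p)
  | fAnd p q => fAnd (rename r p) (rename r q)
  | fOr p q => fOr (rename r p) (rename r q)
  | fImp p q => fImp (rename r p) (rename r q)
  | fAll p => fAll (rename (up r) p)
  | fEx p => fEx (rename (up r) p)
  end.

(** The two assignments are compared pointwise, so that no function
    extensionality is needed. *)
Lemma sat_rename (W : structure) (phi : formula) :
  forall (r : nat -> nat) (s s' : nat -> W),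
    (forall n, s (r n) = s' n) -> (sat s (rename r phi) <-> sat s' phi).
Proof.
  induction phi as [i j|i j|p IHp|p IHp q IHq|p IHp q IHq|p IHp q IHq|p IHp|p IHp];
    intros r s s' E; simpl.
  - rewrite !E; tauto.
  - rewrite !E; tauto.
  - rewrite (IHp r s s' E); tauto.
  - rewrite (IHp r s s' E), (IHq r s s' E); tauto.
  - rewrite (IHp r s s' E), (IHq r s s' E); tauto.
  - rewrite (IHp r s s' E), (IHq r s s' E); tauto.
  - assert (H : forall x, sat (x .: s) (rename (up r) p) <-> sat (x .: s') p).
    { intro x; apply IHp; intros [|n]; simpl; auto. }
    split; intros Hs x; apply H, Hs.
  - assert (H : forall x, sat (x .: s) (rename (up r) p) <-> sat (x .: s') p).
    { intro x; apply IHp; intros [|n]; simpl; auto. }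
    split; intros [x Hx]; exists x; apply H, Hx.
Qed.

Section Definability.

Variable W : structure.
Implicit Types (s : nat -> W) (sigma : nat -> nat + W)
  (p q : (nat -> W) -> W) (P Q : (nat -> W) -> Prop).

Definition eval s (t : nat + W) : W :=
  match t with inl i => s i | inr c => c end.

(** Each variable of the formula is instantiated by a variable or by a
    parameter, so that parameters can be introduced at any place and relations
    with different parameters can be combined. *)
Definition definable P : Prop :=
  exists phi sigma, forall s, P s <-> sat (fun n => eval s (sigma n)) phi.

Definition is_term p : Prop := exists t, forall s, p s = eval s t.

Lemma is_term_var (i : nat) : is_term (fun s => s i).
Proof. exists (inl i); reflexivity. Qed.

Lemma is_term_const (c : W) : is_term (fun _ => c).
Proof. exists (inr c); reflexivity. Qed.

Lemma definable_mem p q :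
  is_term p -> is_term q -> definable (fun s => p s ∈ q s).
Proof.
  intros [t Ht] [u Hu]; exists (fMem 0 1), (t .: (fun _ => u)).
  intro s; simpl; rewrite Ht, Hu; tauto.
Qed.

Lemma definable_eq p q :
  is_term p -> is_term q -> definable (fun s => p s = q s).
Proof.
  intros [t Ht] [u Hu]; exists (fEq 0 1), (t .: (fun _ => u)).
  intro s; simpl; rewrite Ht, Hu; tauto.
Qed.

Lemma definable_class (A : W -> Prop) (HA : is_class A) p :
  is_term p -> definable (fun s => A (p s)).
Proof.
  destruct HA as (phi & s0 & HA); intros [t Ht].
  exists (rename (fun n => n) phi), (t .: (fun n => inr (s0 n))).
  intro s; rewrite HA; symmetry; apply sat_rename.
  intros [|n]; simpl; auto.
Qed.

Lemma definable_not P : definable P -> definable (fun s => ~ P s).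
Proof.
  intros (phi & sigma & H); exists (fNot phi), sigma.
  intro s; simpl; rewrite (H s); tauto.
Qed.

(** Even variables serve the first formula and odd variables the second, so
    that both can be read with the same instantiation. *)
Lemma definable_common P Q :
  definable P -> definable Q ->
  exists phi psi sigma, forall s,
    (P s <-> sat (fun n => eval s (sigma n)) phi) /\
    (Q s <-> sat (fun n => eval s (sigma n)) psi).
Proof.
  intros (phi & sigma & H) (psi & tau & K).
  exists (rename (fun n => 2 * n) phi), (rename (fun n => S (2 * n)) psi).
  exists (fun n => if Nat.even n then sigma (Nat.div2 n) else tau (Nat.div2 n)).
  intro s; rewrite H, K; split; symmetry; apply sat_rename; intro n.
  - now rewrite Nat.even_even, Nat.div2_double.
  - now rewrite <- Nat.add_1_r, Nat.even_odd, Nat.add_1_r, Nat.div2_succ_double.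
Qed.

Lemma definable_and P Q :
  definable P -> definable Q -> definable (fun s => P s /\ Q s).
Proof.
  intros HP HQ; destruct (definable_common P Q HP HQ) as (phi & psi & sigma & H).
  exists (fAnd phi psi), sigma; intro s; simpl; destruct (H s); tauto.
Qed.

Lemma definable_or P Q :
  definable P -> definable Q -> definable (fun s => P s \/ Q s).
Proof.
  intros HP HQ; destruct (definable_common P Q HP HQ) as (phi & psi & sigma & H).
  exists (fOr phi psi), sigma; intro s; simpl; destruct (H s); tauto.
Qed.

Lemma definable_imp P Q :
  definable P -> definable Q -> definable (fun s => P s -> Q s).
Proof.
  intros HP HQ; destruct (definable_common P Q HP HQ) as (phi & psi & sigma & H).
  exists (fImp phi psi), sigma; intro s; simpl; destruct (H s); tauto.
Qed.

(** Separating a variable from the other ones: [pull sigma n] is the place at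
    which [n] is found once the value of variable 0 is put in front, and
    [rest sigma] instantiates what comes after it. *)
Definition pull sigma (n : nat) : nat :=
  match sigma n with inl 0 => 0 | _ => S n end.

Definition rest sigma (n : nat) : nat + W :=
  match sigma n with inl i => inl (pred i) | inr c => inr c end.

Lemma eval_pull sigma s (x : W) (n : nat) :
  (x .: (fun m => eval s (rest sigma m))) (pull sigma n)
  = eval (x .: s) (sigma n).
Proof.
  unfold pull, rest.
  destruct (sigma n) as [[|i]|c] eqn:E; simpl; try rewrite E; reflexivity.
Qed.

Lemma definable_bind (Q : W -> (nat -> W) -> Prop) :
  definable (fun s => Q (s 0) (fun n => s (S n))) ->
  exists phi sigma, forall s x,
    Q x s <-> sat (x .: (fun n => eval s (sigma n))) phi.
Proof.
  intros (phi & sigma & H).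
  exists (rename (pull sigma) phi), (rest sigma); intros s x.
  rewrite (H (x .: s)); symmetry; apply sat_rename.
  intro n; apply eval_pull.
Qed.

Lemma definable_all (Q : W -> (nat -> W) -> Prop) :
  definable (fun s => Q (s 0) (fun n => s (S n))) ->
  definable (fun s => forall x, Q x s).
Proof.
  intro HQ; destruct (definable_bind Q HQ) as (phi & sigma & H).
  exists (fAll phi), sigma; intro s; simpl; split; intros K x; apply H, K.
Qed.

Lemma definable_ex (Q : W -> (nat -> W) -> Prop) :
  definable (fun s => Q (s 0) (fun n => s (S n))) ->
  definable (fun s => exists x, Q x s).
Proof.
  intro HQ; destruct (definable_bind Q HQ) as (phi & sigma & H).
  exists (fEx phi), sigma; intro s; simpl; split;
    intros [x K]; exists x; apply H, K.
Qed.

(** The form in which the schemes take a relation.  The element [w] fills the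
    assignment where no parameter is prescribed. *)
Lemma formula_of_definable (w : W) (R : W -> W -> Prop) :
  definable (fun s => R (s 0) (s 1)) ->
  exists phi t, forall x y, R x y <-> sat (x .: y .: t) phi.
Proof.
  intros (phi & sigma & H).
  exists (rename (up (pull (rest sigma))) (rename (pull sigma) phi)).
  exists (fun n => eval (fun _ => w) (rest (rest sigma) n)); intros x y.
  rewrite (H (x .: y .: (fun _ => w))); symmetry.
  rewrite (sat_rename W _ _ _
             (x .: (fun n => eval (y .: (fun _ => w)) (rest sigma n)))).
  - apply sat_rename; intro n; apply eval_pull.
  - intros [|n]; [reflexivity|]; apply eval_pull.
Qed.

Lemma class_of_definable (w : W) (A : W -> Prop) :
  definable (fun s => A (s 0)) -> is_class A.
Proof.
  intro H; destruct (formula_of_definable w (fun x _ => A x) H) as (phi & t & K).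
  exists phi, (w .: t); intro x; apply K.
Qed.

End Definability.

(** Membership in classes of the context is recognised through the hypotheses
    [is_class _]. *)
Ltac definability :=
  unfold injective_rel, related, elts, is_opair, is_upair, iff;
  repeat match goal with
  | HA : is_class ?A |- definable _ (fun s => ?A _) =>
      apply (definable_class _ A HA)
  | |- definable _ _ =>
      first
        [ apply definable_mem | apply definable_eq | apply definable_ex
        | apply definable_not | apply definable_and | apply definable_or
        | apply definable_all | apply definable_imp ]
  | |- is_term _ _ => first [ apply is_term_var | apply is_term_const ]
  end.

(** * Sets, pairs and proper classes *)

Section Sets.

Variable W : structure.
Hypothesis HW : ZFCminus W.
Implicit Types (x y z a b c e f g i k m n : W) (A : W -> Prop).

Lemma inhabitant : exists w : W, True.
Proof. destruct (empty_set W HW) as [w _]; now exists w. Qed.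

Lemma class_intro A : definable W (fun s => A (s 0)) -> is_class A.
Proof.
  destruct inhabitant as [w _]; apply (class_of_definable W w).
Qed.

Lemma separation A a :
  is_class A -> exists b, forall x, x ∈ b <-> x ∈ a /\ A x.
Proof.
  intros (phi & s & H); destruct (separation_scheme W HW phi s a) as [b Hb].
  exists b; intro x; rewrite H; apply Hb.
Qed.

Lemma foundation A :
  is_class A -> (exists x, A x) ->
  exists x, A x /\ forall y, y ∈ x -> ~ A y.
Proof.
  intros (phi & s & H) [x0 H0].
  destruct (foundation_scheme W HW phi s) as (x & Hx & K).
  - exists x0; now apply H.
  - exists x; split; [now apply H|].
    intros y Hy; rewrite H; now apply K.
Qed.

Lemma opair_exists x y : exists z, is_opair z x y.
Proof.
  destruct (pairing W HW x x) as [a Ha].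
  destruct (pairing W HW x y) as [b Hb].
  destruct (pairing W HW a b) as [z Hz].
  exists z, a, b; auto.
Qed.

Lemma opair_inj z x y x' y' :
  is_opair z x y -> is_opair z x' y' -> x = x' /\ y = y'.
Proof.
  intros (a & b & Ha & Hb & Hz) (a' & b' & Ha' & Hb' & Hz').
  unfold is_upair in *.
  assert (Ex : x = x').
  { assert (K : a = a' \/ a = b') by (apply Hz', Hz; auto).
    destruct K; subst.
    - assert (K : x = x' \/ x = x') by (apply Ha', Ha; auto); tauto.
    - assert (K : x' = x \/ x' = x) by (apply Ha, Hb'; auto); intuition. }
  subst x'; split; [reflexivity|].
  assert (K : b = a' \/ b = b') by (apply Hz', Hz; auto).
  assert (K' : b' = a \/ b' = b) by (apply Hz, Hz'; auto).
  assert (L : y = x \/ y = y').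
  { destruct K; subst.
    - assert (y = x \/ y = x) by (apply Ha', Hb; auto); tauto.
    - apply Hb', Hb; auto. }
  assert (L' : y' = x \/ y' = y).
  { destruct K'; subst.
    - assert (y' = x \/ y' = x) by (apply Ha, Hb'; auto); tauto.
    - apply Hb, Hb'; auto. }
  intuition congruence.
Qed.

Lemma double_union_exists x :
  exists u, forall y, y ∈ u <-> exists z b, z ∈ x /\ b ∈ z /\ y ∈ b.
Proof.
  destruct (unions W HW x) as [v Hv]; destruct (unions W HW v) as [u Hu].
  exists u; intro y; rewrite Hu; split.
  - intros (b & Hb & Hy); apply Hv in Hb as (z & Hz & Hbz); eauto.
  - intros (z & b & Hz & Hb & Hy); exists b; rewrite Hv; eauto.
Qed.

Lemma adjoin_exists a c : exists b, forall x, x ∈ b <-> x ∈ a \/ x = c.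
Proof.
  destruct (pairing W HW c c) as [d Hd]; destruct (pairing W HW a d) as [e He].
  destruct (unions W HW e) as [b Hb]; unfold is_upair in *.
  exists b; intro x; rewrite Hb; split.
  - intros (v & Hv & Hx); apply He in Hv as [->| ->]; [now left|].
    apply Hd in Hx; tauto.
  - intros [Hx| ->]; [exists a|exists d]; rewrite He; split; auto.
    apply Hd; auto.
Qed.

(** A value of a function belongs to its double union because a Kuratowski
    pair contains the unordered pair of its coordinates. *)
Lemma value_in_double_union f i y z :
  is_opair z i y -> z ∈ f -> exists z b, z ∈ f /\ b ∈ z /\ y ∈ b.
Proof.
  intros (a & b & _ & Hb & Hz) Hf; exists z, b; repeat split; auto.
  - apply Hz; auto.
  - apply Hb; auto.
Qed.

(** A proper class is not contained in the set [⋃⋃x], by separation. *)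
Lemma proper_class_escapes A x :
  is_proper_class A ->
  exists y, A y /\ ~ exists z b, z ∈ x /\ b ∈ z /\ y ∈ b.
Proof.
  intros [HA Hset]; apply NNPP; intro N; apply Hset.
  destruct (double_union_exists x) as [u Hu].
  destruct (separation A u HA) as [v Hv].
  exists v; intro y; rewrite Hv, Hu; split; [|tauto].
  intro Hy; split; [|exact Hy].
  apply NNPP; intro K; apply N; now exists y.
Qed.

(** * From injections to class surjections *)

(** A total injective relation from [k] to [A], possibly with several values
    at one argument: injectivity is what makes its inverse a function. *)
Definition injects f k A : Prop :=
  (forall i y, related (elts f) i y -> i ∈ k /\ A y) /\
  (forall i, i ∈ k -> exists y, related (elts f) i y) /\
  injective_rel (elts f).

(** The inverse of [f], extended to all of [A] by the constant value [e]. *)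
Definition inverse_or f e A : W -> Prop :=
  fun z => exists y i, is_opair z y i /\ A y /\
    (related (elts f) i y \/ (i = e /\ ~ exists j, related (elts f) j y)).

Lemma related_inverse_or f e A y i :
  related (inverse_or f e A) y i <->
  A y /\ (related (elts f) i y \/ (i = e /\ ~ exists j, related (elts f) j y)).
Proof.
  split.
  - intros (z & Hz & y' & i' & Hz' & K).
    destruct (opair_inj _ _ _ _ _ Hz Hz'); subst; exact K.
  - intro K; destruct (opair_exists y i) as [z Hz]; exists z; split; auto.
    exists y, i; auto.
Qed.

Lemma delta_big_of_injection A k f :
  is_class A -> ~ is_empty k -> injects f k A -> is_delta_big k A.
Proof.
  intros HA Hk (Hdom & Htot & Hinj).
  apply not_all_ex_not in Hk as [e He]; apply NNPP in He.
  exists (inverse_or f e A); split; [|split; [split|]].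
  - apply class_intro; unfold inverse_or; definability.
  - intros z (y & i & Hz & Hy & _); eauto.
  - intros y Hy.
    destruct (classic (exists j, related (elts f) j y)) as [[j Hj]|N].
    + exists j; split; [apply related_inverse_or; auto|].
      intros i Hi; apply related_inverse_or in Hi as [_ [Hi|[_ N]]].
      * exact (Hinj _ _ _ Hj Hi).
      * exfalso; eauto.
    + exists e; split; [apply related_inverse_or; auto|].
      intros i Hi; apply related_inverse_or in Hi as [_ [Hi|[-> _]]]; auto.
      exfalso; eauto.
  - intro i; split.
    + intro Hi; destruct (Htot i Hi) as [y Hy]; exists y.
      apply related_inverse_or; split; auto; apply (Hdom _ _ Hy).
    + intros [y Hi]; apply related_inverse_or in Hi as [_ [Hi|[-> _]]]; auto.
      apply (Hdom _ _ Hi).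
Qed.

(** * Injections from dependent choice *)

(** Of two different arguments the smaller one lies in the domain of the
    restriction to the larger one, and the value at the larger one was chosen
    outside the double union of that restriction. *)
Lemma injection_of_DC A k :
  is_proper_class A -> is_ordinal k -> DC_scheme k ->
  exists f, injects f k A.
Proof.
  intros HA [_ (_ & _ & Hcomp & _)] HDC.
  destruct inhabitant as [w _].
  assert (HC : is_class A) by apply HA.
  destruct (formula_of_definable W w
    (fun x y => A y /\ ~ exists z b, z ∈ x /\ b ∈ z /\ y ∈ b))
    as (phi & t & Hphi); [definability|].
  destruct (HDC phi t) as (f & [Hdom Hval] & Hf).
  { intro x; destruct (proper_class_escapes A x HA) as [y Hy].
    exists y; now apply Hphi. }
  assert (Hin : forall i y, related (elts f) i y -> i ∈ k).
  { intros i y (z & Hz & Hzf); destruct (Hdom z Hzf) as (i' & y' & Hz' & Hi').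
    destruct (opair_inj _ _ _ _ _ Hz Hz'); subst; exact Hi'. }
  assert (Hstep : forall i y, related (elts f) i y ->
            A y /\ forall j, j ∈ i -> ~ related (elts f) j y).
  { intros i y Hiy; assert (Hi := Hin i y Hiy).
    destruct (Hf i Hi) as (g & y' & Hg & Hiy' & Hsat).
    destruct (Hval i Hi) as (v & _ & Huniq).
    assert (y' = y) by (transitivity v; [symmetry|]; apply Huniq; assumption).
    subst y'.
    apply Hphi in Hsat as [HAy Hout]; split; [exact HAy|].
    intros j Hj (z & Hz & Hzf); apply Hout.
    apply (value_in_double_union g j y z Hz), Hg; eauto. }
  exists f; split; [|split].
  - intros i y Hiy; split; [exact (Hin i y Hiy)|apply (Hstep i y Hiy)].
  - intros i Hi; destruct (Hval i Hi) as (y & Hy & _); eauto.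
  - intros i j y Hi Hj.
    destruct (Hcomp i j (Hin i y Hi) (Hin j y Hj)) as [L|[E|L]]; auto; exfalso.
    + exact (proj2 (Hstep j y Hj) i L Hi).
    + exact (proj2 (Hstep i y Hi) j L Hj).
Qed.

(** * Natural numbers *)

Lemma mem_irrefl x : x ∉ x.
Proof.
  destruct (foundation (fun y => y = x)) as (y & -> & K).
  - apply class_intro; definability.
  - now exists x.
  - intro H; exact (K x H eq_refl).
Qed.

Lemma empty_natural n : is_empty n -> is_natural n.
Proof.
  intro H; split; [split; [|split; [|split; [|split]]]|].
  - intros y Hy; destruct (H y Hy).
  - intros a Ha; destruct (H a Ha).
  - intros a b c Ha; destruct (H a Ha).
  - intros a b Ha; destruct (H a Ha).
  - intros y Hy Hne; destruct Hne; intros z Hz; exact (H z (Hy z Hz)).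
  - intros m [Hm| ->]; [destruct (H m Hm)|now left].
Qed.

(** The least element [m] of [a] outside [b] is [a ∩ b]: elements of [m] lie in
    [b] by minimality, and an element of [a ∩ b] not in [m] would be [m] or
    contain [m], which would put [m] in [b]. *)
Lemma inter_mem_of_not_subset a b c :
  is_ordinal a -> is_ordinal b -> (forall x, x ∈ c <-> x ∈ a /\ x ∈ b) ->
  ~ is_subset a b -> c ∈ a.
Proof.
  intros [Ta (_ & Tr & Ca & Ma)] [Tb _] Hc N.
  destruct (separation (fun x => x ∉ b) a) as [d Hd].
  { apply class_intro; definability. }
  destruct (Ma d) as (m & Hm & Hmin).
  - intros x Hx; now apply Hd.
  - intro E; apply N; intros x Hx; apply NNPP; intro Hxb.
    apply (E x), Hd; auto.
  - apply Hd in Hm as [Hma Hmb].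
    replace c with m; [exact Hma|].
    apply (extensionality W HW); intro x; rewrite Hc; split.
    + intro Hx; assert (Hxa : x ∈ a) by exact (Ta m Hma x Hx).
      split; [exact Hxa|]; apply NNPP; intro Hxb.
      destruct (Hmin x) as [->|Hmx]; [now apply Hd| |].
      * exact (mem_irrefl m Hx).
      * exact (mem_irrefl m (Tr m x m Hma Hxa Hma Hmx Hx)).
    + intros [Hxa Hxb]; destruct (Ca x m Hxa Hma) as [L|[->|L]]; auto.
      * contradiction.
      * exfalso; apply Hmb; exact (Tb x Hxb m L).
Qed.

Lemma ordinal_subset_total a b :
  is_ordinal a -> is_ordinal b -> is_subset a b \/ is_subset b a.
Proof.
  intros Ha Hb; destruct (separation (fun x => x ∈ b) a) as [c Hc].
  { apply class_intro; definability. }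
  apply NNPP; intro N; apply not_or_and in N as [Na Nb].
  apply (mem_irrefl c), Hc; split.
  - exact (inter_mem_of_not_subset a b c Ha Hb Hc Na).
  - apply (inter_mem_of_not_subset b a c Hb Ha); [|exact Nb].
    intro x; rewrite Hc; tauto.
Qed.

Lemma ordinal_mem_of_proper_subset a b :
  is_ordinal a -> is_ordinal b -> is_subset b a -> ~ is_subset a b -> b ∈ a.
Proof.
  intros Ha Hb S N; apply (inter_mem_of_not_subset a b b Ha Hb); auto.
  intro x; split; [intro Hx; split; auto|tauto].
Qed.

Lemma natural_of_not_mem k n :
  is_ordinal k -> is_natural n -> n ∉ k -> is_natural k.
Proof.
  intros Hk [Hn Hnat] N.
  assert (Skn : is_subset k n).
  { apply NNPP; intro K.
    destruct (ordinal_subset_total k n Hk Hn) as [L|L]; [tauto|].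
    apply N; now apply ordinal_mem_of_proper_subset. }
  split; [exact Hk|]; intros m [Hm| ->]; [apply Hnat; left; now apply Skn|].
  apply Hnat; destruct (classic (is_subset n k)) as [Snk|K].
  - right; apply (extensionality W HW); split; auto.
  - left; now apply ordinal_mem_of_proper_subset.
Qed.

Lemma injection_of_succ A x m f :
  is_proper_class A -> is_succ m x -> injects f x A ->
  exists g, injects g m A.
Proof.
  intros HA Hm (Hdom & Htot & Hinj).
  destruct (proper_class_escapes A f HA) as (y & HAy & Hy).
  destruct (opair_exists x y) as [p Hp].
  destruct (adjoin_exists f p) as [g Hg].
  assert (Hrel : forall i v, related (elts g) i v <->
                   related (elts f) i v \/ (i = x /\ v = y)).
  { intros i v; split.
    - intros (z & Hz & Hzg); apply Hg in Hzg as [Hzf| ->].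
      + left; exists z; auto.
      + right; exact (opair_inj _ _ _ _ _ Hz Hp).
    - intros [(z & Hz & Hzf)|[-> ->]]; [exists z|exists p]; split; auto;
        apply Hg; auto. }
  assert (Hnew : forall i, ~ related (elts f) i y).
  { intros i (z & Hz & Hzf); exact (Hy (value_in_double_union f i y z Hz Hzf)). }
  exists g; split; [|split].
  - intros i v H; apply Hrel in H as [H|[-> ->]].
    + destruct (Hdom i v H); split; auto; apply Hm; auto.
    + split; auto; apply Hm; auto.
  - intros i Hi; apply Hm in Hi as [Hi| ->].
    + destruct (Htot i Hi) as [v Hv]; exists v; apply Hrel; auto.
    + exists y; apply Hrel; auto.
  - intros i j v Hi Hj; apply Hrel in Hi as [Hi|[-> ->]];
      apply Hrel in Hj as [Hj|[Ej Ev]]; subst; auto.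
    + exact (Hinj _ _ _ Hi Hj).
    + now apply Hnew in Hi.
    + now apply Hnew in Hj.
Qed.

(** A minimal counterexample among [k] and its elements is empty or a successor,
    and the empty set injects itself; the predecessor of a successor is not a
    counterexample.  Injections that are sets, as opposed to classes, can be
    quantified over in the formula to which foundation is applied. *)
Lemma injection_of_natural A k :
  is_proper_class A -> is_natural k -> exists f, injects f k A.
Proof.
  intros HA [[Tk _] Hnat]; apply NNPP; intro N.
  assert (HC : is_class A) by apply HA.
  destruct (foundation (fun m => (m ∈ k \/ m = k) /\ ~ exists f, injects f m A))
    as (m & [Hm Hbad] & Hmin).
  - apply class_intro; unfold injects; definability.
  - exists k; auto.
  - apply Hbad; destruct (Hnat m Hm) as [Hempty|[x Hx]].
    (* The empty set [m] serves as its own injection. *)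
    + exists m; repeat split.
      * destruct H as (z & _ & Hz); destruct (Hempty z Hz).
      * destruct H as (z & _ & Hz); destruct (Hempty z Hz).
      * intros i Hi; destruct (Hempty i Hi).
      * intros i j y (z & _ & Hz); destruct (Hempty z Hz).
    + assert (Hxm : x ∈ m) by (apply Hx; auto).
      destruct (classic (exists f, injects f x A)) as [[f Hf]|Nx].
      * exact (injection_of_succ A x m f HA Hx Hf).
      * destruct (Hmin x Hxm); split; [|exact Nx].
        left; destruct Hm as [Hm| ->]; [exact (Tk m Hm x Hxm)|exact Hxm].
Qed.

(** * Bigness of proper classes *)

Lemma delta_big_of_DC k :
  is_infinite_cardinal k -> DC_scheme k ->
  forall A, is_proper_class A -> is_delta_big k A.
Proof.
  intros [[Hord _] Hinf] HDC A HA.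
  destruct (injection_of_DC A k HA Hord HDC) as [f Hf].
  apply (delta_big_of_injection A k f (proj1 HA)); [|exact Hf].
  destruct (empty_set W HW) as [o Ho]; intro E.
  exact (E o (Hinf o (empty_natural o Ho))).
Qed.

Lemma big_of_DC :
  DC_lt_Ord_scheme W -> forall A, is_proper_class A -> is_big A.
Proof.
  intros HDC A HA k Hk Hne.
  destruct (classic (is_infinite_cardinal k)) as [Hinf|Hfin].
  - exact (delta_big_of_DC k Hinf (HDC k Hinf) A HA).
  - assert (Hn : exists n, is_natural n /\ n ∉ k).
    { apply NNPP; intro N; apply Hfin; split; [exact Hk|].
      intros n Hn; apply NNPP; intro K; apply N; eauto. }
    destruct Hn as (n & Hn & Hnk).
    destruct (injection_of_natural A k HA) as [f Hf].
    { exact (natural_of_not_mem k n (proj1 Hk) Hn Hnk). }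
    exact (delta_big_of_injection A k f (proj1 HA) Hne Hf).
Qed.

End Sets.

Theorem proposition2p3 (W : structure) (HW : ZFCminus W) :
  (forall delta : W, is_infinite_cardinal delta -> DC_scheme delta ->
     forall A : W -> Prop, is_proper_class A -> is_delta_big delta A) /\
  (DC_lt_Ord_scheme W ->
     forall A : W -> Prop, is_proper_class A -> is_big A).
Proof.
  split; [exact (delta_big_of_DC W HW)|exact (big_of_DC W HW)].
Qed.
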